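(* There is a constant $c$ such that every finitely satisfiable $\mathrm{HCTL}_1$-formula $\varphi$ with $|\varphi|=n$ has a model of depth at most $2^{2^{cn}}$ (i.e. of depth $2^{2^{O(n)}}$).
   Context: Models are rooted trees (finite or infinite), edges directed from parents to children, nodes labelled with sets of atomic propositions; depth of a tree is the supremum of lengths of its root paths. $\mathrm{HCTL}_1$ (one variable $x$): state formulas $\varphi ::= p \mid \neg\varphi \mid \varphi\lor\varphi \mid \varphi\land\varphi \mid \mathsf{E}\mathsf X\varphi\mid\mathsf A\mathsf X\varphi \mid \mathsf{E}(\varphi\mathsf U\varphi)\mid\mathsf A(\varphi\mathsf U\varphi) \mid {\downarrow}x\,\varphi \mid x \mid @_{x}\varphi \mid \mathit{root} \mid @_{\mathit{root}}\varphi$. Semantics at (tree, node $v$, node $u$ assigned to $x$): $p$ holds if $p$ labels $v$; $\mathsf E\mathsf X\varphi$/$\mathsf A\mathsf X\varphi$: some/every child satisfies $\varphi$; $\mathsf E(\varphi_1\mathsf U\varphi_2)$/$\mathsf A(\varphi_1\mathsf U\varphi_2)$: some/every maximal downward path $v=v_0,v_1,\dots$ has $j$ with $\varphi_2$ at $v_j$ and $\varphi_1$ at all $v_l$, $l<j$; ${\downarrow}x\varphi$: $\varphi$ holds at $v$ with $x$ assigned $v$; $x$: $v=u$; $@_x\varphi$: $\varphi$ holds at $u$; $\mathit{root}$: $v$ is the root; $@_{\mathit{root}}\varphi$: $\varphi$ at the root. A tree with root $r$ is a model of $\varphi$ if $\varphi$ holds at $r$ with $x$ assigned $r$; $\varphi$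 is finitely satisfiable if it has a finite model. $|\varphi|$ is the usual formula size. *)

(* Defs.v *)
From mathcomp Require Import all_boot.
From mathcomp Require Import classical_sets cardinality.

Set Implicit Arguments.
Unset Strict Implicit.
Unset Printing Implicit Defensive.

Local Open Scope classical_set_scope.

(* Labelled rooted trees, finite or infinite, of arbitrary branching.
   [tree_reach] forbids cycles, infinite ascending chains and a second
   parentless node. *)
Record tree (AP : Type) : Type := Tree {
  node :> Type;
  tree_root : node;
  parent : node -> option node;
  label : node -> set AP;
  tree_root_parent : parent tree_root = None;
  tree_reach : forall v : node,
    exists k : nat, iter k (obind parent) (Some v) = Some tree_root
}.

Arguments tree_root {AP} t.

Definition child (AP : Type) (t : tree AP) (v w : t) : Prop :=
  parent w = Some v.

Definition finite_tree (AP : Type) (t : tree AP) : Prop :=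
  finite_set [set: node t].

(* [p] lists the nodes of the path after its start [v], so [size p] is the
   number of edges. *)
Fixpoint down_path (AP : Type) (t : tree AP) (v : t) (p : seq t) : Prop :=
  if p is w :: q then child v w /\ down_path w q else True.

Definition root_path_lengths (AP : Type) (t : tree AP) : set nat :=
  [set size p | p in [set p : seq t | down_path (tree_root t) p]].

(* The depth is the supremum of [root_path_lengths t] in the naturals extended
   with infinity; it is at most [d] iff [d] is an upper bound of that set.
   Infinite root paths need no separate treatment: their finite prefixes
   already make the supremum infinite. *)
Definition depth_at_most (AP : Type) (t : tree AP) (d : nat) : Prop :=
  forall l : nat, root_path_lengths t l -> l <= d.

(* A finite or infinite downward path [v_0, v_1, ...] is encoded as
   [pi : nat -> option t] with [pi i = Some v_i] as long as [v_i] exists and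
   [None] afterwards; it may only stop at a leaf. *)
Definition maximal_path (AP : Type) (t : tree AP) (v : t)
    (pi : nat -> option t) : Prop :=
  pi 0 = Some v /\
  forall i : nat,
    match pi i, pi i.+1 with
    | Some u, Some w => child u w
    | Some u, None => forall w : t, ~ child u w
    | None, o => o = None
    end.

Inductive hctl1 (AP : Type) : Type :=
| HAtom of AP
| HNot of hctl1 AP
| HOr of hctl1 AP & hctl1 AP
| HAnd of hctl1 AP & hctl1 AP
| HEX of hctl1 AP
| HAX of hctl1 AP
| HEU of hctl1 AP & hctl1 AP
| HAU of hctl1 AP & hctl1 AP
| HBind of hctl1 AP    (* ↓x φ *)
| HVar                 (* x *)
| HAtVar of hctl1 AP   (* @_x φ *)
| HRoot                (* root *)
| HAtRoot of hctl1 AP. (* @_root φ *)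

Arguments HVar {AP}.
Arguments HRoot {AP}.

(* Number of nodes of the syntax tree. *)
Fixpoint hsize (AP : Type) (phi : hctl1 AP) : nat :=
  match phi with
  | HAtom _ | HVar | HRoot => 1
  | HNot f | HEX f | HAX f | HBind f | HAtVar f | HAtRoot f => (hsize f).+1
  | HOr f g | HAnd f g | HEU f g | HAU f g => (hsize f + hsize g).+1
  end.

Definition until_along (AP : Type) (t : tree AP) (P1 P2 : t -> Prop)
    (pi : nat -> option t) : Prop :=
  exists (j : nat) (w : t),
    [/\ pi j = Some w, P2 w &
        forall (l : nat) (z : t), l < j -> pi l = Some z -> P1 z].

(* [sat phi v u]: [phi] holds at [v] when the variable [x] is assigned [u]. *)
Fixpoint sat (AP : Type) (t : tree AP) (phi : hctl1 AP) (v u : t) : Prop :=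
  match phi with
  | HAtom p => label v p
  | HNot f => ~ sat f v u
  | HOr f g => sat f v u \/ sat g v u
  | HAnd f g => sat f v u /\ sat g v u
  | HEX f => exists w : t, child v w /\ sat f w u
  | HAX f => forall w : t, child v w -> sat f w u
  | HEU f g => exists pi : nat -> option t, maximal_path v pi /\
      until_along (fun w => sat f w u) (fun w => sat g w u) pi
  | HAU f g => forall pi : nat -> option t, maximal_path v pi ->
      until_along (fun w => sat f w u) (fun w => sat g w u) pi
  | HBind f => sat f v v
  | HVar => v = u
  | HAtVar f => sat f u u
  | HRoot => v = tree_root t
  | HAtRoot f => sat f (tree_root t) u
  end.

Definition is_model (AP : Type) (t : tree AP) (phi : hctl1 AP) : Prop :=
  sat phi (tree_root t) (tree_root t).

Definition finitely_satisfiable (AP : Type) (phi : hctl1 AP) : Prop :=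
  exists t : tree AP, finite_tree t /\ is_model t phi.

(* Main.v *)
(* Write V_v(u) for the set of subformulas true at v when x is assigned u.  In a
   finite model, attach to each node v the set of all tuples
   (does u lie below v?, V_u(u), V_root(u), V_v(u)), u ranging over all nodes;
   there are at most 2^(2^(4n)) such profiles.  If a node a other than the root
   and a node b strictly below a have the same profile, the subtree at a can be
   replaced by the subtree at b.  For marks u outside the subtree at a one has
   V_a(u) = V_b(u), because from outside a subtree the mark is felt only through
   V_u(u) and V_root(u); for marks u in the subtree at b, the rest of the tree
   sees the same as it saw for some mark u' in the subtree at a.  So the smaller
   tree is again a model, and a model in which no replacement is possible is
   shallow. *)
Require Import Defs.
From mathcomp Require Import all_boot zify.
From mathcomp Require Import boolp classical_sets cardinality.
From Stdlib Require List.

Set Implicit Arguments.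
Unset Strict Implicit.
Unset Printing Implicit Defensive.

(* [s] enumerates [T], said without equality on [T]. *)
Definition covers (T : Type) (s : seq T) : Prop :=
  forall (P : pred T) (v : T), P v -> has P s.

Lemma covers_of_finite (T : Type) :
  finite_set [set: T] -> exists s : seq T, covers s.
Proof.
move=> /(@finite_seqP {classic T})[s sE]; exists s => P v Pv.
apply/(@hasP {classic T}); exists v => //.
have : [set` s]%classic v by rewrite -sE.
by [].
Qed.

Lemma covers_sig (T : Type) (p : pred T) (s : seq T) :
  covers s -> covers (pmap insub s : seq {x | p x}).
Proof.
move=> cs P v Pv.
(* [P] is extended by false outside the subtype, to get a predicate on [T]. *)
have := cs (fun x => oapp P false (insub x)) (val v); rewrite valK => /(_ Pv).
by elim: s {cs} => //= x s IHs; case: insub => //= y /orP[->|/IHs->]; rewrite ?orbT.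
Qed.

(** Supplies both decreasing measures used later: the nodes below a given node, and the nodes that
    survive a replacement. *)
Lemma ltn_count (T : Type) (p q : pred T) (s : seq T) :
  subpred p q -> has (predD q p) s -> count p s < count q s.
Proof.
move=> pq; elim: s => //= x s IHs /orP[/andP[/negbTE-> ->]|/IHs lt_pq].
  by rewrite ltnS sub_count.
by case px: (p x); rewrite ?(pq _ px) ?ltnS // (leq_trans lt_pq) ?leq_addl.
Qed.

(** * Ancestry: absence of cycles and well-founded descent in finite trees *)

Section Descent.
Variables (AP : Type) (t : tree AP).
Implicit Types u v w a b : t.

Definition up (k : nat) (v : t) : option t :=
  iter k (obind (@parent AP t)) (Some v).

Definition below (a v : t) : Prop := exists k, up k v = Some a.

Lemma upD m k u v : up m u = Some v -> up (k + m) u = up k v.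
Proof. by rewrite /up iterD => ->. Qed.

Lemma up_None m v : up m v = None -> forall k, up (k + m) v = None.
Proof. by rewrite /up => vN k; rewrite iterD vN; elim: k => //= k ->. Qed.

Lemma up_root k : up k.+1 (tree_root t) = None.
Proof. by rewrite -addn1 up_None // /up /= tree_root_parent. Qed.

Lemma up_root_inj k m v :
  up k v = Some (tree_root t) -> up m v = Some (tree_root t) -> k = m.
Proof.
wlog km : k m / k <= m.
  by move=> h vk vm; case/orP: (leq_total k m) => ?; [apply: h|apply/esym/h].
move=> /upD vk; rewrite -(subnK km) vk.
by case: (m - k) => // d; rewrite up_root.
Qed.

(** A cycle of length [m > 0] at [v] would give [v] two distances [k] and [k + m] to the root,
    against [up_root_inj]. *)
Lemma up_fix m v : up m v = Some v -> m = 0.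
Proof.
move=> /upD vm; have [k vk] := tree_reach v.
have := @up_root_inj (k + m) k v; rewrite vm => /(_ vk vk) /eqP.
by rewrite -{2}[k]addn0 eqn_add2l => /eqP.
Qed.

Lemma below_refl a : below a a. Proof. by exists 0. Qed.

Lemma below_trans a b v : below a b -> below b v -> below a v.
Proof. by move=> [k bk] [m vm]; exists (k + m); rewrite (upD _ vm). Qed.

Lemma below_child v w : child v w -> below v w.
Proof. by exists 1. Qed.

Lemma below_parent a v w : child v w -> below a w -> w <> a -> below a v.
Proof.
move=> vw [[|k]]; first by case=> ->.
by rewrite -addn1 (@upD 1 k w v) // => vk _; exists k.
Qed.

Lemma below_anti a b : below a b -> below b a -> a = b.
Proof.
move=> [k bk] [m am].
have: up (m + k) b = Some b by rewrite (upD _ bk).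
move=> /up_fix /eqP; rewrite addn_eq0 => /andP[_ /eqP k0].
by move: bk; rewrite k0 => -[].
Qed.

Lemma child_neq v w : child v w -> v <> w.
Proof. by move=> vw e; rewrite -e in vw; have := @up_fix 1 _ vw. Qed.

Lemma child_not_below v w : child v w -> ~ below w v.
Proof.
by move=> vw /(below_anti (below_child vw)) e; apply: (child_neq vw).
Qed.

Lemma below_root a : below a (tree_root t) -> a = tree_root t.
Proof. by move=> [[[]//|k]]; rewrite up_root. Qed.

(** The count of enumerated nodes below [v] drops on passing to a child [w], because [v] itself is
    lost. *)
Lemma child_wf (s : seq t) :
  covers s -> well_founded (fun w v => child v w).
Proof.
move=> cs v.
have [n] := ubnP (count (fun z => `[< below v z >]) s).
elim: n v => [v|n IHn v]; first by rewrite ltn0.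
rewrite ltnS => le_vn.
constructor=> w vw; apply: IHn; apply: leq_trans le_vn.
apply: ltn_count => [z /asboolP wz|].
  by apply/asboolP/(below_trans (below_child vw)).
apply: (cs _ v) => /=; apply/andP; split; last exact/asboolP/below_refl.
by apply/asboolPn/child_not_below.
Qed.

Lemma down_path_drop (x0 v : t) (p : seq t) i :
  down_path v p -> i < size p -> down_path (nth x0 p i) (drop i.+1 p).
Proof.
elim: p v i => //= w p IHp v [|i] [vw wp]; first by rewrite drop0.
by move=> ltip; apply: (IHp w).
Qed.

Lemma down_path_below (x0 v : t) (p : seq t) i : down_path v p ->
  i < size p -> below v (nth x0 p i) /\ nth x0 p i <> v.
Proof.
elim: p v i => //= w p IHp v [|i] [vw wp] ltip.
  by split=> [|wv]; [apply: below_child|apply: (child_neq vw)].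
have [wi _] := IHp _ _ wp ltip; split.
  by apply: below_trans wi; apply: below_child.
by move=> /= e; rewrite e in wi; apply: child_not_below wi.
Qed.

Lemma down_path_nth (x0 v : t) (p : seq t) i j : down_path v p ->
  i < j -> j < size p ->
  below (nth x0 p i) (nth x0 p j) /\ nth x0 p j <> nth x0 p i.
Proof.
move=> vp ij jp; have ip := ltn_trans ij jp.
have := @down_path_below x0 _ _ (j - i.+1) (down_path_drop x0 vp ip).
rewrite nth_drop subnKC // size_drop; apply.
by apply: ltn_sub2r => //; apply: leq_ltn_trans jp.
Qed.

(** * The until operators as recursions over children *)

Section Until.
Hypothesis wf : well_founded (fun w v : t => child v w).
Variables P Q : t -> Prop.
Implicit Type pi : nat -> option t.

Definition path_cons v pi : nat -> option t :=
  fun i => if i is j.+1 then pi j else Some v.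

Lemma maximal_path_cons v w pi :
  child v w -> maximal_path w pi -> maximal_path v (path_cons v pi).
Proof. by move=> vw [pi0 pimax]; split=> // -[|i] /=; rewrite ?pi0 //; apply: pimax. Qed.

Lemma maximal_path_tail v w pi : maximal_path v pi -> pi 1 = Some w ->
  child v w /\ maximal_path w (fun i => pi i.+1).
Proof.
move=> [pi0 pimax] pi1; have := pimax 0; rewrite pi0 pi1; split=> //.
by split=> // i; apply: pimax.
Qed.

Lemma maximal_path_stop v pi : maximal_path v pi -> pi 1 = None ->
  (forall w, ~ child v w) /\ forall i, pi i.+1 = None.
Proof.
move=> [pi0 pimax] pi1; have := pimax 0; rewrite pi0 pi1; split=> //.
by elim=> // i IHi; have := pimax i.+1; rewrite IHi.
Qed.

(** Follow children until a leaf stops the descent. Such a path witnesses EU once [Q v] holds, and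
    keeps AU from being vacuous. *)
Lemma maximal_path_exists v : exists pi, maximal_path v pi.
Proof.
elim/(well_founded_ind wf): v => v IHv.
have [[w vw]|noc] := pselect (exists w, child v w).
  by have [pi wpi] := IHv _ vw; exists (path_cons v pi); apply: maximal_path_cons wpi.
exists (path_cons v (fun=> None)); split=> // -[|i] //= w vw.
by apply: noc; exists w.
Qed.

Lemma until_along_unfold v pi : pi 0 = Some v ->
  until_along P Q pi <-> Q v \/ P v /\ until_along P Q (fun i => pi i.+1).
Proof.
move=> pi0; split=> [[[|j] [w [pij Qw Pl]]]|[Qv|[Pv [j [w [pij Qw Pl]]]]]].
- by left; move: pij; rewrite pi0 => -[->].
- right; split; first exact: (Pl 0).
  by exists j, w; split=> // l z lj; apply: Pl.
- by exists 0, v.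
by exists j.+1, w; split=> // -[|l] z lj; [rewrite pi0 => -[<-]|apply: Pl].
Qed.

Definition exists_until v : Prop :=
  exists pi, maximal_path v pi /\ until_along P Q pi.

Definition forall_until v : Prop :=
  forall pi, maximal_path v pi -> until_along P Q pi.

(** Trades paths for the child relation, so that EU can be treated by induction on descent. *)
Lemma exists_until_unfold v : exists_until v <->
  Q v \/ P v /\ exists w, child v w /\ exists_until w.
Proof.
split=> [[pi [vpi]]|[Qv|[Pv [w [vw [pi [wpi Upi]]]]]]].
- have [pi0 _] := vpi.
  rewrite (until_along_unfold pi0) => -[|[Pv Upi]]; [by left|right; split=> //].
  case pi1: (pi 1) => [w|].
    have [vw wpi] := maximal_path_tail vpi pi1.
    by exists w; split=> //; exists (fun i => pi i.+1).
  have [_ piN] := maximal_path_stop vpi pi1.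
  by case: Upi => j [w []]; rewrite piN.
- have [pi vpi] := maximal_path_exists v; exists pi; split=> //.
  by have [pi0 _] := vpi; apply/(until_along_unfold pi0); left.
exists (path_cons v pi); split; first exact: maximal_path_cons wpi.
by apply/(@until_along_unfold v) => //; right.
Qed.

(* On a leaf the unfolding must not hold vacuously, hence the third conjunct. *)
Lemma forall_until_unfold v : forall_until v <->
  Q v \/ P v /\ (exists w, child v w) /\ forall w, child v w -> forall_until w.
Proof.
split=> [Uv|[Qv|[Pv [[w vw] Uw]]] pi vpi].
- have [Qv|nQv] := pselect (Q v); [by left|right].
  have [pi vpi] := maximal_path_exists v; have [pi0 _] := vpi.
  have /(until_along_unfold pi0)[//|[Pv Upi]] := Uv _ vpi.
  split=> //; split.
    case pi1: (pi 1) => [w|]; first by have [vw _] := maximal_path_tail vpi pi1; exists w.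
    have [_ piN] := maximal_path_stop vpi pi1.
    by case: Upi => j [w []]; rewrite piN.
  move=> w vw rho wrho.
  have /(@until_along_unfold v)[//|//|[]//] := Uv _ (maximal_path_cons vw wrho).
- by have [pi0 _] := vpi; apply/(until_along_unfold pi0); left.
have [pi0 _] := vpi; apply/(until_along_unfold pi0); right; split=> //.
case pi1: (pi 1) => [z|].
  by have [vz zpi] := maximal_path_tail vpi pi1; apply: Uw zpi.
by have [/(_ w)] := maximal_path_stop vpi pi1.
Qed.

End Until.
End Descent.

(** Repetitions are kept, so the length is exactly [hsize f] and no equality test on [AP] is
    needed. *)
Fixpoint subs (AP : Type) (f : hctl1 AP) : seq (hctl1 AP) :=
  f :: match f with
  | HAtom _ | HVar | HRoot => [::]
  | HNot g | HEX g | HAX g | HBind g | HAtVar g | HAtRoot g => subs g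
  | HOr g h | HAnd g h | HEU g h | HAU g h => subs g ++ subs h
  end.

Lemma size_subs (AP : Type) (f : hctl1 AP) : size (subs f) = hsize f.
Proof.
by elim: f => //= [f->|f IHf g IHg|f IHf g IHg|f->|f->|f IHf g IHg|f IHf g IHg|f->|f->|f->];
  rewrite // size_cat IHf IHg.
Qed.

Lemma in_nth (T : Type) (x0 x : T) (s : seq T) :
  List.In x s -> exists2 i, i < size s & nth x0 s i = x.
Proof.
elim: s => //= y s IHs [->|/IHs[i lti <-]]; first by exists 0.
by exists i.+1.
Qed.

Lemma in_subs (AP : Type) (f : hctl1 AP) : List.In f (subs f).
Proof. by case: f => *; left. Qed.

Lemma subs_incl (AP : Type) (f g : hctl1 AP) :
  List.In f (subs g) -> List.incl (subs f) (subs g).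
Proof.
elim: g => [p|g IHg|g IHg h IHh|g IHg h IHh|g IHg|g IHg|g IHg h IHh|g IHg h IHh
           |g IHg||g IHg||g IHg] [<-|gf] //; apply: List.incl_tl; try exact: IHg.
all: have [/IHg|/IHh] := List.in_app_or _ _ _ gf;
  by [apply: List.incl_appl|apply: List.incl_appr].
Qed.

(* Replacing the subtree at [a] by the subtree at a node [b] below it: [b]
   becomes a child of the parent of [a]. *)
Section Splice.
Variables (AP : Type) (t : tree AP) (a b : t).
Hypotheses (ab : below a b) (a_root : a <> tree_root t).
Implicit Types u v w : t.

Definition kept : pred t := fun v => `[< ~ below a v \/ below b v >].

Definition splice_node : Type := {v : t | kept v}.

Definition new_parent v : option t :=
  if `[< v = b >] then parent a else parent v.

Definition splice_parent (x : splice_node) : option splice_node :=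
  obind insub (new_parent (val x)).

Definition in_b (x : splice_node) : bool := `[< below b (val x) >].

Lemma not_below_root : ~ below a (tree_root t).
Proof. by move=> /below_root. Qed.

Lemma b_root : b <> tree_root t.
Proof. by move=> e; move: ab; rewrite e; apply: not_below_root. Qed.

Lemma kept_root : kept (tree_root t).
Proof. by apply/asboolP; left; apply: not_below_root. Qed.

Lemma kept_b : kept b.
Proof. by apply/asboolP; right; apply: below_refl. Qed.

Lemma in_bN (x : splice_node) : in_b x = false -> ~ below a (val x).
Proof. by move=> /negbT/asboolPn xb; case: (asboolP _ (valP x)). Qed.

Lemma new_parent_kept v w : kept v -> new_parent v = Some w -> kept w.
Proof.
rewrite /new_parent => /asboolP kv; case: asboolP => [_|vb] vw; apply/asboolP.
  by left; apply: child_not_below.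
case: kv => [av|bv]; last by right; apply: (below_parent vw).
by left=> aw; apply/av/(below_trans aw)/below_child.
Qed.

(** [insub] never fails here, as the new parent of a kept node is kept; edges of the spliced tree
    can thus be computed in [t]. *)
Lemma splice_parentE (x : splice_node) :
  omap val (splice_parent x) = new_parent (val x).
Proof.
rewrite /splice_parent; case E: (new_parent _) => [w|] //=.
by rewrite (insubT kept (new_parent_kept (valP x) E)).
Qed.

(** Strong induction on the distance to the root in [t]: the new parent is strictly closer, also for
    [b], since [a] lies on the way from [b] to the root. *)
Lemma new_parent_reach v :
  exists k, iter k (obind new_parent) (Some v) = Some (tree_root t).
Proof.
have [k] := tree_reach v.
elim/ltn_ind: k v => k IHk v vk.
have [->|vr] := pselect (v = tree_root t); first by exists 0.
suff [w [m [vw mk wm]]] : exists w m,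
    [/\ new_parent v = Some w, m < k & up m w = Some (tree_root t)].
  have [l wl] := IHk _ mk _ wm.
  by exists l.+1; rewrite iterSr /= vw.
rewrite /new_parent; case: asboolP => [vb|_].
- have [m bm] := ab; rewrite vb in vk.
  (* The climb of [m] steps from [b] to [a] cannot pass the root. *)
  have mk : m <= k.
    rewrite leqNgt; apply/negP=> km; move: (upD (m - k) vk).
    rewrite subnK 1?ltnW // bm -(subnSK km) up_root //.
  have am : up (k - m) a = Some (tree_root t) by rewrite -(upD _ bm) subnK.
  case E: (k - m) => [|d] in am; first by case: am.
  case pa: (parent a) => [w|]; last first.
    by have := @up_None _ _ 1 a pa d; rewrite addn1 am.
  exists w, d; split=> //; first by rewrite (leq_trans _ (leq_subr m k)) // E.
  by rewrite -am -addn1 (upD (m := 1) _ pa).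
case: k vk {IHk} => [|k]; first by case.
case pv: (parent v) => [w|] vk; last first.
  by have := @up_None _ _ 1 v pv k; rewrite addn1 [up _ _]vk.
by exists w, k; split=> //; rewrite -[RHS]vk -[in RHS]addn1 -(upD (m := 1) _ pv).
Qed.

Lemma splice_root_parent : splice_parent (Sub (tree_root t) kept_root) = None.
Proof.
have := splice_parentE (Sub (tree_root t) kept_root).
rewrite SubK /new_parent; case: asboolP => [/esym/b_root//|_].
by rewrite tree_root_parent; case: splice_parent.
Qed.

Lemma splice_reach (x : splice_node) : exists k,
  iter k (obind splice_parent) (Some x) = Some (Sub (tree_root t) kept_root).
Proof.
have [k vk] := new_parent_reach (val x); exists k.
apply/(@inj_omap _ _ val val_inj); rewrite /= -vk.
elim: k {vk} => //= k <-.
by case: (iter k _ _) => //= y; apply: splice_parentE.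
Qed.

Definition splice : tree AP :=
  @Tree AP splice_node (Sub (tree_root t) kept_root) splice_parent
    (fun x => label (val x)) splice_root_parent splice_reach.

Lemma child_splice (x y : splice) :
  child x y <-> new_parent (val y) = Some (val x).
Proof.
rewrite -splice_parentE /child /=; case: (splice_parent y) => [z|] //=.
by split=> -[]; [move=> ->|move=> /val_inj ->].
Qed.

(** [XB] describes [X] inside the subtree at [b], [XA] outside it. The only edge that may be new
    leads from the parent of [a] to [b]; it replaces the edge to [a], and [XA a <-> XB b] pays for
    the exchange. *)
Lemma exists_child_splice (X : splice -> Prop) (XA XB : t -> Prop) (x : splice) :
  (forall y, child x y -> X y <-> if in_b y then XB (val y) else XA (val y)) ->
  (XA a <-> XB b) ->
  (exists y, child x y /\ X y) <->
  (if in_b x then exists w, child (val x) w /\ XB w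
   else exists w, child (val x) w /\ XA w).
Proof.
move=> XE Xab; case xb: (in_b x); split.
- move=> [y [xy /(XE _ xy) Xy]]; move/child_splice: (xy); rewrite /new_parent.
  case: asboolP => [_|yb] vxy.
    (* The replaced edge cannot start inside the subtree at [b]: the parent of [a] is not below
       [a]. *)
    case: (child_not_below vxy); apply: below_trans ab _; exact/asboolP.
  exists (val y); split=> //; move: Xy; rewrite /in_b ifT //.
  by apply/asboolP/below_trans/(below_child vxy)/asboolP.
- move=> [w [xw Xw]].
  have bw : below b w by apply/below_trans/(below_child xw)/asboolP.
  have kw : kept w by apply/asboolP; right.
  have xy : child x (Sub w kw : splice).
    apply/child_splice; rewrite SubK /new_parent; case: asboolP => // wb.
    by rewrite wb in xw; case: (child_not_below xw); exact/asboolP.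
  exists (Sub w kw); split=> //; apply/(XE _ xy).
  by rewrite /in_b SubK ifT //; apply/asboolP.
- have nax := in_bN xb.
  move=> [y [xy /(XE _ xy) Xy]]; move/child_splice: (xy); rewrite /new_parent.
  case: asboolP => [yb|yb] vxy.
    exists a; split=> //; apply/Xab; move: Xy; rewrite yb ifT //.
    by rewrite /in_b yb; apply/asboolP/below_refl.
  exists (val y); split=> //; move: Xy; rewrite ifF //.
  apply/negbTE/asboolPn => bvy; apply: nax; apply: below_trans ab _.
  exact: below_parent vxy bvy yb.
have nax := in_bN xb.
move=> [w [xw Xw]]; have [wa|wa] := pselect (w = a).
  (* [a] may be gone, and [b] answers for it as a child of [x]. *)
  have xy : child x (Sub b kept_b : splice).
    by apply/child_splice; rewrite SubK /new_parent asboolT // -wa.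
  exists (Sub b kept_b); split=> //; apply/(XE _ xy).
  rewrite /in_b SubK ifT; last exact/asboolP/below_refl.
  by apply/Xab; rewrite -wa.
have naw : ~ below a w by move=> aw; apply: nax; apply: below_parent aw wa.
have kw : kept w by apply/asboolP; left.
have xy : child x (Sub w kw : splice).
  apply/child_splice; rewrite SubK /new_parent; case: asboolP => // wb.
  by rewrite wb in naw.
exists (Sub w kw); split=> //; apply/(XE _ xy).
rewrite /in_b SubK ifF //; apply/negbTE/asboolPn => bw.
by apply: naw; apply: below_trans bw.
Qed.

(** The existential case applied to the negated predicates. *)
Lemma forall_child_splice (X : splice -> Prop) (XA XB : t -> Prop) (x : splice) :
  (forall y, child x y -> X y <-> if in_b y then XB (val y) else XA (val y)) ->
  (XA a <-> XB b) ->
  (forall y, child x y -> X y) <->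
  (if in_b x then forall w, child (val x) w -> XB w
   else forall w, child (val x) w -> XA w).
Proof.
move=> XE Xab.
have notE (T : Type) (C Y : T -> Prop) :
    (forall y, C y -> Y y) <-> ~ exists y, C y /\ ~ Y y.
  split=> [CY [y [/CY]]//|nE y Cy]; apply: contrapT => nY.
  by apply: nE; exists y.
rewrite notE (@exists_child_splice _ (fun w => ~ XA w) (fun w => ~ XB w)).
- by case: (in_b x); rewrite -notE.
- by move=> y /XE ->; case: (in_b y).
by rewrite Xab.
Qed.

End Splice.

(** * How truth in a subtree depends on a mark outside it *)

Section Subformulas.
Variables (AP : Type) (t : tree AP).
Hypothesis wf : well_founded (fun w v : t => child v w).
Implicit Types (f g phi : hctl1 AP) (u v w a b : t).

Lemma sat_EU f g v u : sat (HEU f g) v u <->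
  sat g v u \/ sat f v u /\ exists w, child v w /\ sat (HEU f g) w u.
Proof. exact: (exists_until_unfold wf (fun w => sat f w u)). Qed.

Lemma sat_AU f g v u : sat (HAU f g) v u <->
  sat g v u \/
  sat f v u /\ (exists w, child v w) /\
  forall w, child v w -> sat (HAU f g) w u.
Proof. exact: (forall_until_unfold wf (fun w => sat f w u)). Qed.

Definition agree phi v u v' u' : Prop :=
  forall f, List.In f (subs phi) -> (sat f v u <-> sat f v' u').

(* Seen from a mark [u] outside the subtree at [b], that subtree depends on [u]
   only through the truth values at [u] and at the root. *)
Lemma sat_outside phi b u u' :
  ~ below b u -> ~ below b u' -> agree phi u u u' u' ->
  agree phi (tree_root t) u (tree_root t) u' ->
  forall f, List.incl (subs f) (subs phi) ->
  forall w, below b w -> (sat f w u <-> sat f w u').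
Proof.
move=> bu bu' Bu Ru.
have step v w : below b v -> child v w -> below b w.
  by move=> bv /below_child; apply: below_trans.
elim=> [p|f IHf|f IHf g IHg|f IHf g IHg|f IHf|f IHf|f IHf g IHg|f IHf g IHg
       |f IHf||f IHf||f IHf] //= sub0 w bw;
  have [phiF sub] := List.incl_cons_inv sub0.
- by rewrite IHf.
- by have [/IHf{}IHf /IHg{}IHg] := List.incl_app_inv _ _ sub; rewrite IHf // IHg.
- by have [/IHf{}IHf /IHg{}IHg] := List.incl_app_inv _ _ sub; rewrite IHf // IHg.
- by split=> -[z [wz fz]]; exists z; split=> //; apply/(IHf sub _ (step _ _ bw wz)).
- by split=> H z wz; apply/(IHf sub _ (step _ _ bw wz))/H.
- have [/IHf{}IHf /IHg{}IHg] := List.incl_app_inv _ _ sub.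
  (* Unfolding EU brings back the same formula at the children, hence an inner induction on
     descent. *)
  elim/(well_founded_ind wf): w bw => w IHw bw.
  rewrite -!/(sat (HEU f g) _ _) !sat_EU IHf // IHg //.
  suff -> : (exists z, child w z /\ sat (HEU f g) z u) <->
            (exists z, child w z /\ sat (HEU f g) z u') by [].
  by split=> -[z [wz fz]]; exists z; split=> //;
    apply/(IHw _ wz (step _ _ bw wz)).
- have [/IHf{}IHf /IHg{}IHg] := List.incl_app_inv _ _ sub.
  elim/(well_founded_ind wf): w bw => w IHw bw.
  rewrite -!/(sat (HAU f g) _ _) !sat_AU IHf // IHg //.
  suff E : (forall z, child w z -> sat (HAU f g) z u) <->
           (forall z, child w z -> sat (HAU f g) z u').
    by rewrite E.
  by split=> H z wz; apply/(IHw _ wz (step _ _ bw wz))/H.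
(* [x] fails everywhere below [b] for both marks; the two jumps that follow are settled by [Bu] and
   [Ru]. *)
- by split=> e; [case: bu|case: bu']; rewrite -e.
- by apply/Bu/sub/in_subs.
by apply/Ru/sub/in_subs.
Qed.

End Subformulas.

(** * Preservation of truth under splicing *)

Section SatSplice.
Variables (AP : Type) (t : tree AP) (a b : t) (phi : hctl1 AP).
Hypotheses (ab : below a b) (a_root : a <> tree_root t).
Hypothesis wf : well_founded (fun w v : t => child v w).
Local Notation t' := (splice ab a_root).
Hypothesis wf' : well_founded (fun w v : t' => child v w).

(* [mu y] is a mark of [t] that looks from outside the subtree at [a] as the
   mark [y] of the spliced tree looks from there. *)
Variable mu : t' -> t.
Hypothesis mu_out : forall y : t', ~ below a (val y) -> mu y = val y.
Hypothesis mu_in : forall y : t', below b (val y) -> below a (mu y).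
Hypothesis mu_self : forall y : t', agree phi (val y) (val y) (mu y) (mu y).
Hypothesis mu_root :
  forall y : t', agree phi (tree_root t) (val y) (tree_root t) (mu y).
Hypothesis mu_ab : forall y : t', agree phi b (val y) a (mu y).

(** The subtree at [b] is copied unchanged and so sees the true mark; the outside still sees the old
    subtree at [a], in which [mu y] stands in for [y]. *)
Definition mark (x y : t') : t := if in_b x then val y else mu y.

Let val_injS (x y : t') : val x = val y -> x = y.
Proof. exact: (@val_inj _ _ (splice_node a b)). Qed.

(** Induction on [f]. Entering [b] from outside is paid for by [mu_ab], jumps to the mark and to the
    root by [mu_self] and [mu_root], the test [x] by [mu_out] and [mu_in]. *)
Lemma sat_splice f : List.incl (subs f) (subs phi) ->
  forall x y : t', sat f x y <-> sat f (val x) (mark x y).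
Proof.
have in_b_root : in_b (tree_root t') = false.
  by apply/negbTE/asboolPn => /(below_trans ab)/(not_below_root a_root).
(* On an edge from [x] to [z], [mark z y] and [mark x y] can differ only if the edge enters [b] from
   outside. *)
have exE (F : hctl1 AP) (X : t' -> Prop) (x y : t') :
    List.In F (subs phi) ->
    (forall z, child x z -> X z <-> sat F (val z) (mark z y)) ->
    (exists z, child x z /\ X z) <->
    exists w, child (val x) w /\ sat F w (mark x y).
  move=> phiF XE.
  rewrite (@exists_child_splice _ _ _ _ ab a_root X
             (fun w => sat F w (mu y)) (fun w => sat F w (val y))).
  - by rewrite /mark; case: (in_b x).
  - by move=> z /XE ->; rewrite /mark; case: (in_b z).
  by rewrite (mu_ab y phiF).
have allE (F : hctl1 AP) (X : t' -> Prop) (x y : t') :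
    List.In F (subs phi) ->
    (forall z, child x z -> X z <-> sat F (val z) (mark z y)) ->
    (forall z, child x z -> X z) <->
    forall w, child (val x) w -> sat F w (mark x y).
  move=> phiF XE.
  rewrite (@forall_child_splice _ _ _ _ ab a_root X
             (fun w => sat F w (mu y)) (fun w => sat F w (val y))).
  - by rewrite /mark; case: (in_b x).
  - by move=> z /XE ->; rewrite /mark; case: (in_b z).
  by rewrite (mu_ab y phiF).
have childE (x : t') : (exists z, child x z) <-> exists w, child (val x) w.
  have [] := @exists_child_splice _ _ _ _ ab a_root (fun=> True)
    (fun=> True) (fun=> True) x; [by move=> z; case: (in_b z)|by []|].
  by case: (in_b x) => L R; split=> -[z xz];
    [have [|w []] := L|have [|w []] := R|have [|w []] := L|have [|w []] := R];
    try (by exists z); exists w.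
have mark_self (x : t') : mark x x = val x.
  by rewrite /mark; case xb: (in_b x) => //; apply/mu_out/(in_bN xb).
elim: f => [p|f IHf|f IHf g IHg|f IHf g IHg|f IHf|f IHf|f IHf g IHg|f IHf g IHg
       |f IHf||f IHf||f IHf] sub0 x y;
  have [phiF sub] := List.incl_cons_inv sub0.
- by [].
- by rewrite /= IHf.
- by have [/IHf{}IHf /IHg{}IHg] := List.incl_app_inv _ _ sub; rewrite /= IHf IHg.
- by have [/IHf{}IHf /IHg{}IHg] := List.incl_app_inv _ _ sub; rewrite /= IHf IHg.
- by apply: exE => [|z _]; [apply/sub/in_subs|apply: IHf].
- by apply: allE => [|z _]; [apply/sub/in_subs|apply: IHf].
- have [/IHf{}IHf /IHg{}IHg] := List.incl_app_inv _ _ sub.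
  elim/(well_founded_ind wf'): x => x IHx.
  by rewrite (sat_EU wf') (sat_EU wf) IHf IHg (exE _ _ _ _ phiF (fun z xz => IHx z xz)).
- have [/IHf{}IHf /IHg{}IHg] := List.incl_app_inv _ _ sub.
  elim/(well_founded_ind wf'): x => x IHx.
  rewrite (sat_AU wf') (sat_AU wf) IHg.
  by rewrite IHf childE (allE _ _ _ _ phiF (fun z xz => IHx z xz)).
- by rewrite /= IHf // mark_self.
- rewrite /= /mark; case xb: (in_b x).
    by split=> [->|/val_injS].
  (* Conversely, if [mu y] is the outside node [val x], then [mu_in] keeps [y] out of the subtree at
     [b]; being kept, [y] is outside that at [a], and [mu_out] applies. *)
  have nax := in_bN xb; split=> [<-|xy]; first by rewrite mu_out.
  apply: val_injS; apply: (etrans xy); apply: mu_out.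
  by have [|/mu_in] := asboolP _ (valP y); rewrite -?xy.
- rewrite /= IHf // mark_self /mark; case: (in_b x) => //.
  exact/mu_self/sub/in_subs.
- by split=> [->//|xr]; apply: val_injS.
rewrite /= IHf // /mark in_b_root; case: (in_b x) => //.
by apply: iff_sym; apply/mu_root/sub/in_subs.
Qed.

End SatSplice.

Section Profiles.
Variables (AP : Type) (t : tree AP) (phi : hctl1 AP).
Implicit Types u v a b : t.

(** Indexed by positions in [subs phi]; by [size_subs] the default [HRoot] is never read. *)
Definition truth_vector v u : {ffun 'I_(hsize phi) -> bool} :=
  [ffun i : 'I__ => `[< sat (nth HRoot (subs phi) i) v u >]].

Lemma truth_vector_agree v u v' u' :
  truth_vector v u = truth_vector v' u' -> agree phi v u v' u'.
Proof.
move=> e f /(in_nth HRoot)[i]; rewrite size_subs => lti <-.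
have /ffunP/(_ (Ordinal lti)) := e; rewrite !ffunE => E.
by split=> /asboolP; [rewrite E|rewrite -E] => /asboolP.
Qed.

Definition mark_profile v u :=
  (`[< below v u >], truth_vector u u, truth_vector (tree_root t) u,
   truth_vector v u).

Definition profile v := [set x | `[< exists u, x = mark_profile v u >]].

Lemma profile_agree a b u : profile a = profile b ->
  exists u', [/\ below b u <-> below a u', agree phi u u u' u',
    agree phi (tree_root t) u (tree_root t) u' & agree phi b u a u'].
Proof.
move=> /setP/(_ (mark_profile b u)); rewrite !inE => e.
have /asboolP[u'] : `[< exists u', mark_profile b u = mark_profile a u' >].
  by rewrite e; apply/asboolP; exists u.
case=> eb /truth_vector_agree ? /truth_vector_agree ? /truth_vector_agree ?.
by exists u'; split=> //; split=> /asboolP; [rewrite eb|rewrite -eb] => /asboolP.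
Qed.

Lemma splice_model a b (ab : below a b) (a_root : a <> tree_root t) (s : seq t) :
  covers s -> profile a = profile b ->
  is_model t phi -> is_model (splice ab a_root) phi.
Proof.
move=> cs eab tphi; have wf := child_wf cs.
have wf' := child_wf (covers_sig (p := kept a b) cs : @covers (splice ab a_root) _).
have /choice[mu muP] : forall y : splice ab a_root, exists u,
    [/\ ~ below a (val y) -> u = val y, below b (val y) -> below a u,
        agree phi (val y) (val y) u u,
        agree phi (tree_root t) (val y) (tree_root t) u &
        agree phi b (val y) a u].
  move=> y; have [nay|ay] := asboolP (~ below a (val y)).
    exists (val y); split=> //; first by move=> /(below_trans ab).
    (* An outside mark represents itself. The profiles match its view from [a] with that of some
       [u'] from [b]; both marks lie outside the subtree at [b], so [sat_outside] exchanges them. *)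
    have [u' [bu' Bu' Ru' Vu']] := profile_agree (val y) (esym eab).
    move=> f phif; rewrite (Vu' f phif).
    apply: (sat_outside wf _ _ Bu' Ru' (subs_incl phif) (below_refl b)).
      by move=> /(below_trans ab).
    by rewrite -bu'.
  have [u [bu Bu Ru Vu]] := profile_agree (val y) eab.
  by exists u; split=> // /bu.
rewrite /is_model (sat_splice wf wf' (mu := mu) _ _ _ _ _ (List.incl_refl _)).
- by rewrite /mark; case: ifP => // _; have [-> //] := muP (tree_root (splice ab a_root));
    exact: not_below_root.
- by move=> y; have [] := muP y.
- by move=> y; have [] := muP y.
- by move=> y; have [] := muP y.
- by move=> y; have [] := muP y.
- by move=> y; have [] := muP y.
Qed.

(** With [n = hsize phi] there are 2^(3n+1) tuples, and 3n+1 <= 4n because n is positive. *)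
Lemma card_profile : #|{set bool * {ffun 'I_(hsize phi) -> bool}
    * {ffun 'I_(hsize phi) -> bool} * {ffun 'I_(hsize phi) -> bool}}| <=
  2 ^ (2 ^ (4 * hsize phi)).
Proof.
rewrite -cardsT -powersetT card_powerset cardsT !card_prod card_bool card_ffun.
rewrite card_bool card_ord leq_pexp2l // -expnS -!expnD leq_pexp2l //.
have : 0 < hsize phi by case: phi.
by lia.
Qed.

End Profiles.

(** Pigeonhole: a root path longer than the number of profiles repeats one. The list [p] omits its
    start, so the upper of the two nodes is not the root and can be spliced. *)
Lemma depth_or_shrink (AP : Type) (phi : hctl1 AP) (t : tree AP) (s : seq t) :
  covers s -> is_model t phi -> ~ depth_at_most t (2 ^ (2 ^ (4 * hsize phi))) ->
  exists (t' : tree AP) (s' : seq t'),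
    [/\ covers s', size s' < size s & is_model t' phi].
Proof.
move=> cs tphi deep.
have [p rp lt_p] : exists2 p : seq t, down_path (tree_root t) p &
    2 ^ (2 ^ (4 * hsize phi)) < size p.
  apply: contrapT => np; apply: deep => l [p rp <-]; rewrite leqNgt.
  by apply/negP => lt_p; apply: np; exists p.
set x0 := tree_root t.
have /(uniqPn (profile phi x0))[i [j [ij jp eij]]] : ~~ uniq [seq profile phi v | v <- p].
  apply/negP => /card_uniqP; rewrite size_map => cp.
  have := leq_trans (max_card (mem [seq profile phi v | v <- p])) (card_profile phi).
  by rewrite cp leqNgt lt_p.
rewrite size_map in jp; have ip := ltn_trans ij jp.
rewrite !(nth_map x0) // in eij.
set a := nth x0 p i in eij; set b := nth x0 p j in eij.
have [ab ba] : below a b /\ b <> a := down_path_nth x0 rp ij jp.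
have [_ a_root] : below x0 a /\ a <> x0 := down_path_below x0 rp ip.
exists (splice ab a_root), (pmap insub s); split.
- exact: covers_sig.
- rewrite size_pmap_sub -(count_predT s); apply: ltn_count => //.
  (* [a] itself is discarded, as [b] is strictly below it. *)
  apply: (cs _ a); rewrite /= andbT; apply/asboolPn => -[]; first by apply; apply: below_refl.
  by move=> /(below_anti ab)/esym.
exact: splice_model cs eij tphi.
Qed.

Theorem theorem6 :
  exists c : nat, forall (AP : Type) (phi : hctl1 AP),
    finitely_satisfiable phi ->
    exists t : tree AP,
      is_model t phi /\ depth_at_most t (2 ^ (2 ^ (c * hsize phi))).
Proof.
(* The constant comes from [card_profile]. Each splice shortens the enumeration, so the process ends
   in a shallow model. *)
exists 4 => AP phi [t [/covers_of_finite[s cs] tphi]].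
have [n] := ubnP (size s).
elim: n => [|n IHn] in t s cs tphi *; first by rewrite ltn0.
rewrite ltnS => le_sn.
have [tshallow|deep] := pselect (depth_at_most t (2 ^ (2 ^ (4 * hsize phi)))).
  by exists t.
have [t' [s' [cs' lt_s t'phi]]] := depth_or_shrink cs tphi deep.
exact: IHn cs' t'phi (leq_trans lt_s le_sn).
Qed.
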